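(* Let $\mathtt K$ be a 2-category, let $\mathbb T_1,\mathbb T_2$ be 2-monads on $\mathtt K$ and let $\lambda:\mathbb T_1\mathbb T_2\Rightarrow\mathbb T_2\mathbb T_1$ be an invertible distributive law. Let $(A,\alpha_1,\phi_1)$ be a normalized lax $\mathbb T_1$-algebra, let $(A,\alpha_2,\phi_2)$ be a normalized lax $\mathbb T_2$-algebra with the same underlying object $A\in\mathtt K$, and let $\psi:\alpha_1\cdot\mathbb T_1\alpha_2\Rightarrow\alpha_2\cdot\mathbb T_2\alpha_1\cdot\lambda_A$ be a lax rewriting rule of $(A,\alpha_1,\phi_1)$ over $(A,\alpha_2,\phi_2)$. Then the composite $$\alpha:=\alpha_2\cdot\mathbb T_2\alpha_1:\mathbb T_{21}A=\mathbb T_2\mathbb T_1A\to A$$ is a (normalized) lax $\mathbb T_{21}$-algebra, for the composite 2-monad $\mathbb T_{21}=\mathbb T_2\mathbb T_1$, with associativity constraint $\phi_{21}:\alpha\cdot\mathbb T_{21}\alpha\Rightarrow\alpha\cdot\mu_{21}(A)$ given by the vertical composite $$\phi_{21}=\big(\alpha_2\cdot\mu_2(A)\cdot\mathbb T_2^2\phi_1\cdot\mathbb T_2\lambda_{\mathbb T_1A}\big)\ \Box\ \big(\phi_2\cdot\mathbb T_2^2\alpha_1\cdot\mathbb T_2^2\mathbb T_1\alpha_1\cdot\mathbb T_2\lambda_{\mathbb T_1A}\big)\ \Box\ \big(\alpha_2\cdot\mathbb T_2\psi\cdot\mathbb T_2\mathbb T_1\mathbb T_2\alpha_1\big).$$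
   Context: All 2-categories and 2-monads are strict. The dot $\cdot$ denotes composition of 1-cells, whiskering and horizontal composition; $\Box$ denotes vertical composition of 2-cells, written right to left ($\gamma\Box\beta$ means first $\beta$, then $\gamma$). The 2-monads are $(\mathbb T_i,\mu_i,\eta_i)$, $\mu_i:\mathbb T_i^2\Rightarrow\mathbb T_i$, $\eta_i:\mathrm{id}\Rightarrow\mathbb T_i$. Distributive law: a 2-natural transformation $\lambda:\mathbb T_1\mathbb T_2\Rightarrow\mathbb T_2\mathbb T_1$ with $\lambda\cdot\mu_1\mathbb T_2=\mathbb T_2\mu_1\cdot\lambda\mathbb T_1\cdot\mathbb T_1\lambda$, $\lambda\cdot\eta_1\mathbb T_2=\mathbb T_2\eta_1$, $\lambda\cdot\mathbb T_1\mu_2=\mu_2\mathbb T_1\cdot\mathbb T_2\lambda\cdot\lambda\mathbb T_2$, $\lambda\cdot\mathbb T_1\eta_2=\eta_2\mathbb T_1$. The composite 2-monad is $\mathbb T_{21}=\mathbb T_2\mathbb T_1$ with $\mu_{21}=\mu_2\mathbb T_1\cdot\mathbb T_2^2\mu_1\cdot\mathbb T_2\lambda\mathbb T_1$ and $\eta_{21}=\eta_2\mathbb T_1\cdot\eta_1$. Normalized lax algebra for a 2-monad $(\mathbb T,\mu,\eta)$: an object $A$, a 1-cell $\alpha:\mathbb TA\to A$ and a 2-cell $\phi:\alpha\cdot\mathbb T\alpha\Rightarrow\alpha\cdot\mu_A$ such that $\alpha\cdot\eta_A=\mathrm{id}_A$, $\phi\cdot\mathbb T\eta_A=\mathrm{id}_\alpha$,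 $\phi\cdot\eta_{\mathbb TA}=\mathrm{id}_\alpha$ and $$(\phi\cdot\mu_{\mathbb TA})\,\Box\,(\phi\cdot\mathbb T^2\alpha)=(\phi\cdot\mathbb T\mu_A)\,\Box\,(\alpha\cdot\mathbb T\phi).$$ Lax rewriting rule of a lax $\mathbb T_1$-algebra $(A,\alpha_1,\phi_1)$ over a lax $\mathbb T_2$-algebra $(A,\alpha_2,\phi_2)$: a 2-cell $\psi:\alpha_1\cdot\mathbb T_1\alpha_2\Rightarrow\alpha_2\cdot\mathbb T_2\alpha_1\cdot\lambda_A$ (between 1-cells $\mathbb T_1\mathbb T_2A\to A$) such that (a) $(\psi\cdot\mu_1(\mathbb T_2A))\,\Box\,(\phi_1\cdot\mathbb T_1^2\alpha_2)=(\alpha_2\cdot\mathbb T_2\phi_1\cdot\lambda_{\mathbb T_1A}\cdot\mathbb T_1\lambda_A)\,\Box\,(\psi\cdot\mathbb T_1\mathbb T_2\alpha_1\cdot\mathbb T_1\lambda_A)\,\Box\,(\alpha_1\cdot\mathbb T_1\psi)$; (b) $(\phi_2\cdot\mathbb T_2^2\alpha_1\cdot\mathbb T_2\lambda_A\cdot\lambda_{\mathbb T_2A})\,\Box\,(\alpha_2\cdot\mathbb T_2\psi\cdot\lambda_{\mathbb T_2A})\,\Box\,(\psi\cdot\mathbb T_1\mathbb T_2\alpha_2)=(\psi\cdot\mathbb T_1\mu_2(A))\,\Box\,(\alpha_1\cdot\mathbb T_1\phi_2)$; (c) $\psi\cdot\eta_1(\mathbb T_2A)=\mathrm{id}_{\alpha_2}$;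 (d) $\psi\cdot\mathbb T_1\eta_2(A)=\mathrm{id}_{\alpha_1}$. *)

(* Defs.v *)
(* No library beyond the Rocq prelude is used. *)

Set Implicit Arguments.
Unset Strict Implicit.
Unset Printing Implicit Defensive.

(* In a strict 2-category composition of 1-cells is associative and unital only
   up to a propositional equality, so an equation between 2-cells may relate two
   types [cell f g] and [cell f' g'] that are equal without being convertible.
   [heq b b'] says that the boundaries agree and that, along this agreement, the
   2-cells agree: it is equality in the sigma-type of all 2-cells with boundary. *)
Inductive heq {X : Type} {C : X -> X -> Type} {f g : X} (b : C f g) :
  forall f' g' : X, C f' g' -> Prop :=
| heq_refl : heq b b.
Arguments heq {X C f g} b {f' g'} b'.
Arguments heq_refl {X C f g b}.

Record TwoCat := {
  ob :> Type;
  hom : ob -> ob -> Type;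
  cell : forall A B : ob, hom A B -> hom A B -> Type;
  id1 : forall A : ob, hom A A;
  comp1 : forall A B C : ob, hom B C -> hom A B -> hom A C;
  id2 : forall (A B : ob) (f : hom A B), cell f f;
  vcomp : forall (A B : ob) (f g h : hom A B), cell g h -> cell f g -> cell f h;
  hcomp : forall (A B C : ob) (g g' : hom B C) (f f' : hom A B),
    cell g g' -> cell f f' -> cell (comp1 g f) (comp1 g' f');
  comp1A : forall (A B C D : ob) (h : hom C D) (g : hom B C) (f : hom A B),
    comp1 (comp1 h g) f = comp1 h (comp1 g f);
  comp1_idl : forall (A B : ob) (f : hom A B), comp1 (id1 B) f = f;
  comp1_idr : forall (A B : ob) (f : hom A B), comp1 f (id1 A) = f;
  vcompA : forall (A B : ob) (f g h k : hom A B)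
    (d : cell h k) (c : cell g h) (b : cell f g),
    vcomp (vcomp d c) b = vcomp d (vcomp c b);
  vcomp_idl : forall (A B : ob) (f g : hom A B) (b : cell f g),
    vcomp (id2 g) b = b;
  vcomp_idr : forall (A B : ob) (f g : hom A B) (b : cell f g),
    vcomp b (id2 f) = b;
  hcomp_id2 : forall (A B C : ob) (g : hom B C) (f : hom A B),
    hcomp (id2 g) (id2 f) = id2 (comp1 g f);
  interchange : forall (A B C : ob) (g g' g'' : hom B C) (f f' f'' : hom A B)
    (d' : cell g' g'') (d : cell g g') (b' : cell f' f'') (b : cell f f'),
    hcomp (vcomp d' d) (vcomp b' b) = vcomp (hcomp d' b') (hcomp d b);
  hcompA : forall (A B C D : ob) (h h' : hom C D) (g g' : hom B C)
    (f f' : hom A B) (d : cell h h') (c : cell g g') (b : cell f f'),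
    heq (C := @cell A D) (hcomp (hcomp d c) b) (hcomp d (hcomp c b));
  hcomp_idl : forall (A B : ob) (f f' : hom A B) (b : cell f f'),
    heq (C := @cell A B) (hcomp (id2 (id1 B)) b) b;
  hcomp_idr : forall (A B : ob) (f f' : hom A B) (b : cell f f'),
    heq (C := @cell A B) (hcomp b (id2 (id1 A))) b
}.

Arguments hom {t} _ _.
Arguments cell {t A B} _ _.
Arguments id1 {t} A.
Arguments comp1 {t A B C} _ _.
Arguments id2 {t A B} f.
Arguments vcomp {t A B f g h} _ _.
Arguments hcomp {t A B C g g' f f'} _ _.

Definition lwhisker {K : TwoCat} {A B C : K} (g : hom B C) {f f' : hom A B}
  (b : cell f f') : cell (comp1 g f) (comp1 g f') := hcomp (id2 g) b.

Definition rwhisker {K : TwoCat} {A B C : K} {g g' : hom B C}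
  (b : cell g g') (f : hom A B) : cell (comp1 g f) (comp1 g' f) :=
  hcomp b (id2 f).

(* Vertical composition of 2-cells whose middle boundaries are only
   propositionally equal. *)
Definition vcomp_along {K : TwoCat} {A B : K} {f g g' h : hom A B}
  (c : cell g' h) (e : g = g') (b : cell f g) : cell f h :=
  vcomp c (match e in _ = x return cell f x with eq_refl => b end).

Definition cast_cell {K : TwoCat} {A B : K} {f f' g g' : hom A B}
  (ef : f = f') (eg : g = g') (b : cell f g) : cell f' g' :=
  match ef in _ = x, eg in _ = y return cell x y with
  | eq_refl, eq_refl => b
  end.

Declare Scope twocat_scope.
Delimit Scope twocat_scope with twocat.
Open Scope twocat_scope.

Notation "b ≃ c" := (heq (C := @cell _ _ _) b c)
  (at level 70, no associativity) : twocat_scope.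
Notation "g · f" := (comp1 g f) (at level 40, left associativity) : twocat_scope.
Notation "g ◁ b" := (lwhisker g b) (at level 40, left associativity) : twocat_scope.
Notation "b ▷ f" := (rwhisker b f) (at level 40, left associativity) : twocat_scope.
Notation "c □[ e ] b" := (vcomp_along c e b)
  (at level 48, right associativity, format "c  □[ e ]  b") : twocat_scope.

Record TwoFunctor (C D : TwoCat) := {
  map0 :> C -> D;
  map1 : forall A B : C, hom A B -> hom (map0 A) (map0 B);
  map2 : forall (A B : C) (f g : hom A B), cell f g -> cell (map1 f) (map1 g);
  map1_id : forall A : C, map1 (id1 A) = id1 (map0 A);
  map1_comp : forall (A B E : C) (g : hom B E) (f : hom A B),
    map1 (g · f) = map1 g · map1 f;
  map2_id : forall (A B : C) (f : hom A B), map2 (id2 f) = id2 (map1 f);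
  map2_vcomp : forall (A B : C) (f g h : hom A B) (c : cell g h) (b : cell f g),
    map2 (vcomp c b) = vcomp (map2 c) (map2 b);
  map2_hcomp : forall (A B E : C) (g g' : hom B E) (f f' : hom A B)
    (c : cell g g') (b : cell f f'),
    map2 (hcomp c b) ≃ hcomp (map2 c) (map2 b)
}.

Arguments map1 {C D} t {A B} _.
Arguments map2 {C D} t {A B f g} _.

Notation "F $ f" := (map1 F f) (at level 35, right associativity) : twocat_scope.
Notation "F $$ b" := (map2 F b) (at level 35, right associativity) : twocat_scope.

Lemma heq_sym {X : Type} {C : X -> X -> Type} {f g f' g' : X}
  (b : C f g) (b' : C f' g') : heq b b' -> heq b' b.
Proof. intros []; exact heq_refl. Qed.

Lemma heq_trans {X : Type} {C : X -> X -> Type} {f g f' g' f'' g'' : X}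
  (b : C f g) (b' : C f' g') (b'' : C f'' g'') :
  heq b b' -> heq b' b'' -> heq b b''.
Proof. intros H []; exact H. Qed.

Lemma heq_eq {X : Type} {C : X -> X -> Type} {f g : X} (b b' : C f g) :
  b = b' -> heq b b'.
Proof. intros []; exact heq_refl. Qed.

Lemma heq_hcomp {K : TwoCat} {A B C : K}
  {g h g' h' : hom B C} {p q p' q' : hom A B}
  (c : cell g h) (c' : cell g' h') (b : cell p q) (b' : cell p' q') :
  c ≃ c' -> b ≃ b' -> hcomp c b ≃ hcomp c' b'.
Proof. intros [] []; exact heq_refl. Qed.

Lemma heq_map2 {C D : TwoCat} (F : TwoFunctor C D) {A B : C}
  {p q p' q' : hom A B} (b : cell p q) (b' : cell p' q') :
  b ≃ b' -> F $$ b ≃ F $$ b'.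
Proof. intros []; exact heq_refl. Qed.

Lemma heq_id2 {K : TwoCat} {A B : K} {f f' : hom A B} :
  f = f' -> id2 f ≃ id2 f'.
Proof. intros []; exact heq_refl. Qed.

Definition functor_id (C : TwoCat) : TwoFunctor C C.
Proof.
  refine {| map0 := fun A : C => A;
            map1 := fun A B (f : hom A B) => f;
            map2 := fun A B (f g : hom A B) (b : cell f g) => b |};
    intros; solve [reflexivity | exact heq_refl].
Defined.

Definition functor_comp {C D E : TwoCat} (G : TwoFunctor D E)
  (F : TwoFunctor C D) : TwoFunctor C E.
Proof.
  refine {| map0 := fun A : C => G (F A);
            map1 := fun A B (f : hom A B) => G $ F $ f;
            map2 := fun A B (f g : hom A B) (b : cell f g) => G $$ F $$ b |}.
  - abstract (intros; now rewrite !map1_id).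
  - abstract (intros; now rewrite !map1_comp).
  - abstract (intros; now rewrite !map2_id).
  - abstract (intros; now rewrite !map2_vcomp).
  - abstract (intros; eapply heq_trans;
      [exact (heq_map2 G (map2_hcomp F c b)) | apply map2_hcomp]).
Defined.

Notation "G ∘ F" := (functor_comp G F)
  (at level 40, left associativity) : twocat_scope.

Record TwoNat {C D : TwoCat} (F G : TwoFunctor C D) := {
  component :> forall A : C, hom (F A) (G A);
  nat1 : forall (A B : C) (f : hom A B),
    component B · F $ f = G $ f · component A;
  nat2 : forall (A B : C) (f g : hom A B) (b : cell f g),
    component B ◁ F $$ b ≃ G $$ b ▷ component A
}.

(* The laws of a 2-monad, like those of a distributive law below, are equations
   between 2-natural transformations, written componentwise. *)
Record TwoMonad (K : TwoCat) := {
  endo :> TwoFunctor K K;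
  mu : TwoNat (endo ∘ endo) endo;
  eta : TwoNat (functor_id K) endo;
  mu_assoc : forall A : K, mu A · endo $ mu A = mu A · mu (endo A);
  mu_unitl : forall A : K, mu A · eta (endo A) = id1 (endo A);
  mu_unitr : forall A : K, mu A · endo $ eta A = id1 (endo A)
}.

Arguments mu {K} t.
Arguments eta {K} t.

Record DistributiveLaw {K : TwoCat} (T1 T2 : TwoMonad K) := {
  dlaw :> TwoNat (T1 ∘ T2) (T2 ∘ T1);
  dlaw_mu1 : forall A : K,
    dlaw A · mu T1 (T2 A) = T2 $ mu T1 A · dlaw (T1 A) · T1 $ dlaw A;
  dlaw_eta1 : forall A : K, dlaw A · eta T1 (T2 A) = T2 $ eta T1 A;
  dlaw_mu2 : forall A : K,
    dlaw A · T1 $ mu T2 A = mu T2 (T1 A) · T2 $ dlaw A · dlaw (T2 A);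
  dlaw_eta2 : forall A : K, dlaw A · T1 $ eta T2 A = eta T2 (T1 A)
}.

Definition invertible {C D : TwoCat} {F G : TwoFunctor C D} (n : TwoNat F G) :
  Prop :=
  exists m : TwoNat G F,
    (forall A : C, m A · n A = id1 (F A)) /\ (forall A : C, n A · m A = id1 (G A)).


Lemma comp_pre {K : TwoCat} {A B C X : K} {g : hom B C} {f : hom A B} {k : hom A C}
  (e : g · f = k) (h : hom X A) : g · (f · h) = k · h.
Proof. now rewrite <- comp1A, e. Qed.

Lemma map1_eq {K : TwoCat} (T : TwoFunctor K K) {A B C : K} {g : hom B C} {f : hom A B}
  {k : hom A C} (e : g · f = k) : T $ g · T $ f = T $ k.
Proof. now rewrite <- map1_comp, e. Qed.

Definition mu21_component {K : TwoCat} {T1 T2 : TwoMonad K}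
  (l : DistributiveLaw T1 T2) (A : K) : hom (T2 (T1 (T2 (T1 A)))) (T2 (T1 A)) :=
  mu T2 (T1 A) · T2 $ T2 $ mu T1 A · T2 $ l (T1 A).

Definition eta21_component {K : TwoCat} (T1 T2 : TwoMonad K) (A : K) :
  hom A (T2 (T1 A)) :=
  eta T2 (T1 A) · eta T1 A.

Ltac push_in H :=
  cbn in H; unfold mu21_component, eta21_component in H; cbn in H;
  rewrite ?map1_comp, ?comp1A in H.

Ltac push := cbn; unfold mu21_component, eta21_component; cbn;
  rewrite ?map1_comp, ?comp1A.

Tactic Notation "rw" uconstr(e) :=
  let H := fresh in pose proof e as H; push_in H;
  first [ rewrite H
        | let H' := fresh in
          pose proof (fun X => comp_pre (X := X) H) as H';
          push_in H'; rewrite H'; clear H' ];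
  clear H; push.

Section CompositeMonad.
Context {K : TwoCat}.

Lemma mu_nat (T : TwoMonad K) {A B : K} (f : hom A B) :
  mu T B · T $ T $ f = T $ f · mu T A.
Proof. exact (nat1 (mu T) f). Qed.

Lemma eta_nat (T : TwoMonad K) {A B : K} (f : hom A B) :
  eta T B · f = T $ f · eta T A.
Proof. exact (nat1 (eta T) f). Qed.

Context {T1 T2 : TwoMonad K} (l : DistributiveLaw T1 T2).

Lemma dlaw_nat {A B : K} (f : hom A B) :
  l B · T1 $ T2 $ f = T2 $ T1 $ f · l A.
Proof. exact (nat1 l f). Qed.

Lemma nat2_comp {A A' B C : K} {f g : hom A B} {f' g' : hom A' C}
  {n : hom A A'} {m : hom B C} {D : K} {C' : K} {f'' g'' : hom C' D}
  {n' : hom A' C'} {m' : hom C D}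
  {b : cell f g} {b' : cell f' g'} {b'' : cell f'' g''} :
  m ◁ b ≃ b' ▷ n -> m' ◁ b' ≃ b'' ▷ n' -> (m' · m) ◁ b ≃ b'' ▷ (n' · n).
Proof.
unfold lwhisker, rwhisker; intros H H'.
rewrite <- !hcomp_id2.
eapply heq_trans; [apply hcompA|].
eapply heq_trans; [exact (heq_hcomp heq_refl H)|].
eapply heq_trans; [apply heq_sym, hcompA|].
eapply heq_trans; [exact (heq_hcomp H' heq_refl)|].
apply hcompA.
Qed.

Lemma nat2_map (T : TwoFunctor K K) {A A' B C : K} {f g : hom A B}
  {f' g' : hom A' C} {n : hom A A'} {m : hom B C}
  {b : cell f g} {b' : cell f' g'} :
  m ◁ b ≃ b' ▷ n -> T $ m ◁ T $$ b ≃ T $$ b' ▷ T $ n.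
Proof.
unfold lwhisker, rwhisker; intros H.
rewrite <- !map2_id.
eapply heq_trans; [apply heq_sym, map2_hcomp|].
eapply heq_trans; [exact (heq_map2 T H)|].
apply map2_hcomp.
Qed.

Lemma mu21_nat1 {A B : K} (f : hom A B) :
  mu21_component l B · T2 $ T1 $ T2 $ T1 $ f
  = T2 $ T1 $ f · mu21_component l A.
Proof.
push.
rw (map1_eq T2 (dlaw_nat (T1 $ f))).
rw (map1_eq T2 (map1_eq T2 (mu_nat T1 f))).
rw (mu_nat T2 (T1 $ f)).
reflexivity.
Qed.

Lemma mu21_nat2 {A B : K} {f g : hom A B} (b : cell f g) :
  mu21_component l B ◁ T2 $$ T1 $$ T2 $$ T1 $$ b
  ≃ T2 $$ T1 $$ b ▷ mu21_component l A.
Proof.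
exact (nat2_comp (nat2_map T2 (nat2 l (T1 $$ b)))
        (nat2_comp (nat2_map T2 (nat2_map T2 (nat2 (mu T1) b)))
                   (nat2 (mu T2) (T1 $$ b)))).
Qed.

Lemma eta21_nat1 {A B : K} (f : hom A B) :
  eta21_component T1 T2 B · f = T2 $ T1 $ f · eta21_component T1 T2 A.
Proof.
push.
rw (eta_nat T1 f).
rw (eta_nat T2 (T1 $ f)).
reflexivity.
Qed.

Lemma eta21_nat2 {A B : K} {f g : hom A B} (b : cell f g) :
  eta21_component T1 T2 B ◁ b ≃ T2 $$ T1 $$ b ▷ eta21_component T1 T2 A.
Proof.
exact (nat2_comp (nat2 (eta T1) b) (nat2 (eta T2) (T1 $$ b))).
Qed.

Definition mu21 : TwoNat ((T2 ∘ T1) ∘ (T2 ∘ T1)) (T2 ∘ T1) :=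
  @Build_TwoNat K K ((T2 ∘ T1) ∘ (T2 ∘ T1)) (T2 ∘ T1)
    (mu21_component l) (@mu21_nat1) (@mu21_nat2).

Definition eta21 : TwoNat (functor_id K) (T2 ∘ T1) :=
  @Build_TwoNat K K (functor_id K) (T2 ∘ T1)
    (eta21_component T1 T2) (@eta21_nat1) (@eta21_nat2).

Lemma mu21_assoc (A : K) :
  mu21 A · (T2 ∘ T1) $ mu21 A = mu21 A · mu21 ((T2 ∘ T1) A).
Proof.
push.
rw (map1_eq T2 (dlaw_mu2 l (T1 A))).
rw (map1_eq T2 (dlaw_nat (T2 $ mu T1 A))).
rw (map1_eq T2 (dlaw_nat (l (T1 A)))).
rw (map1_eq T2 (map1_eq T2 (dlaw_nat (mu T1 A)))).
rw (map1_eq T2 (mu_nat T2 (T1 $ mu T1 A))).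
rw (map1_eq T2 (map1_eq T2 (mu_assoc T1 A))).
rw (map1_eq T2 (eq_sym (mu_nat T2 (mu T1 (T1 A))))).
rw (map1_eq T2 (eq_sym (mu_nat T2 (mu T1 A)))).
rw (mu_assoc T2 (T1 A)).
rw (eq_sym (mu_nat T2 (l (T1 A)))).
rw (eq_sym (mu_nat T2 (T2 $ mu T1 A))).
rw (map1_eq T2 (map1_eq T2 (dlaw_mu1 l (T1 A)))).
reflexivity.
Qed.

Lemma mu21_unitl (A : K) :
  mu21 A · eta21 ((T2 ∘ T1) A) = id1 ((T2 ∘ T1) A).
Proof.
push.
rw (eq_sym (eta_nat T2 (l (T1 A)))).
rw (dlaw_eta1 l (T1 A)).
rw (eq_sym (eta_nat T2 (T2 $ mu T1 A))).
rw (map1_eq T2 (mu_unitl T1 A)).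
rewrite map1_id, comp1_idr.
exact (mu_unitl T2 (T1 A)).
Qed.

Lemma mu21_unitr (A : K) :
  mu21 A · (T2 ∘ T1) $ eta21 A = id1 ((T2 ∘ T1) A).
Proof.
push.
rw (map1_eq T2 (dlaw_eta2 l (T1 A))).
rw (map1_eq T2 (eta_nat T2 (T1 $ eta T1 A))).
rw (map1_eq T2 (map1_eq T2 (mu_unitr T1 A))).
rewrite !map1_id, comp1_idl.
exact (mu_unitr T2 (T1 A)).
Qed.

Definition composite_monad : TwoMonad K :=
  {| endo := T2 ∘ T1;
     mu := mu21;
     eta := eta21;
     mu_assoc := mu21_assoc;
     mu_unitl := mu21_unitl;
     mu_unitr := mu21_unitr |}.

End CompositeMonad.

Section LaxAlgebras.
Context {K : TwoCat}.

(* The lemmas [.._bdry..] record the equalities of 1-cells (functoriality, naturality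
   and associativity only) at which the vertical composites below are formed. *)
Lemma lax_assoc_bdry_l (T : TwoMonad K) {A : K} (a : hom (T A) A) :
  a · mu T A · T $ T $ a = a · T $ a · mu T (T A).
Proof. push; rw (mu_nat T a); reflexivity. Qed.

Lemma lax_assoc_bdry_r (T : TwoMonad K) {A : K} (a : hom (T A) A) :
  a · T $ (a · mu T A) = a · T $ a · T $ mu T A.
Proof. push; reflexivity. Qed.

Record is_normalized_lax_algebra (T : TwoMonad K) (A : K) (a : hom (T A) A)
  (phi : cell (a · T $ a) (a · mu T A)) : Prop := {
  lax_unit : a · eta T A = id1 A;
  lax_unitl : phi ▷ T $ eta T A ≃ id2 a;
  lax_unitr : phi ▷ eta T (T A) ≃ id2 a;
  lax_assoc :
    phi ▷ mu T (T A) □[lax_assoc_bdry_l a] phi ▷ T $ T $ a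
    ≃ phi ▷ T $ mu T A □[lax_assoc_bdry_r a] a ◁ T $$ phi
}.

Context {T1 T2 : TwoMonad K} (l : DistributiveLaw T1 T2) {A : K}.
Variables (a1 : hom (T1 A) A) (a2 : hom (T2 A) A).

Lemma rw_mult1_bdry_l :
  a1 · mu T1 A · T1 $ T1 $ a2 = a1 · T1 $ a2 · mu T1 (T2 A).
Proof. push; rw (mu_nat T1 a2); reflexivity. Qed.

Lemma rw_mult1_bdry_r1 :
  a1 · T1 $ (a2 · T2 $ a1 · l A) = a1 · T1 $ a2 · T1 $ T2 $ a1 · T1 $ l A.
Proof. push; reflexivity. Qed.

Lemma rw_mult1_bdry_r2 :
  a2 · T2 $ a1 · l A · T1 $ T2 $ a1 · T1 $ l A
  = a2 · T2 $ (a1 · T1 $ a1) · l (T1 A) · T1 $ l A.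
Proof. push; rw (dlaw_nat l a1); reflexivity. Qed.

Lemma rw_mult2_bdry_l1 :
  a2 · T2 $ a1 · l A · T1 $ T2 $ a2 = a2 · T2 $ (a1 · T1 $ a2) · l (T2 A).
Proof. push; rw (dlaw_nat l a2); reflexivity. Qed.

Lemma rw_mult2_bdry_l2 :
  a2 · T2 $ (a2 · T2 $ a1 · l A) · l (T2 A)
  = a2 · T2 $ a2 · T2 $ T2 $ a1 · T2 $ l A · l (T2 A).
Proof. push; reflexivity. Qed.

Lemma rw_mult2_bdry_r :
  a1 · T1 $ (a2 · mu T2 A) = a1 · T1 $ a2 · T1 $ mu T2 A.
Proof. push; reflexivity. Qed.

Record is_lax_rewriting_rule
  (phi1 : cell (a1 · T1 $ a1) (a1 · mu T1 A))
  (phi2 : cell (a2 · T2 $ a2) (a2 · mu T2 A))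
  (psi : cell (a1 · T1 $ a2) (a2 · T2 $ a1 · l A)) : Prop := {
  rewriting_mult1 :
    psi ▷ mu T1 (T2 A) □[rw_mult1_bdry_l] phi1 ▷ T1 $ T1 $ a2
    ≃ a2 ◁ T2 $$ phi1 ▷ l (T1 A) ▷ T1 $ l A
      □[rw_mult1_bdry_r2] psi ▷ T1 $ T2 $ a1 ▷ T1 $ l A
      □[rw_mult1_bdry_r1] a1 ◁ T1 $$ psi;
  rewriting_mult2 :
    phi2 ▷ T2 $ T2 $ a1 ▷ T2 $ l A ▷ l (T2 A)
      □[rw_mult2_bdry_l2] a2 ◁ T2 $$ psi ▷ l (T2 A)
      □[rw_mult2_bdry_l1] psi ▷ T1 $ T2 $ a2
    ≃ psi ▷ T1 $ mu T2 A □[rw_mult2_bdry_r] a1 ◁ T1 $$ phi2;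
  rewriting_unit1 : psi ▷ eta T1 (T2 A) ≃ id2 a2;
  rewriting_unit2 : psi ▷ T1 $ eta T2 A ≃ id2 a1
}.

Lemma phi21_bdry_src :
  a2 · T2 $ (a1 · T1 $ a2) · T2 $ T1 $ T2 $ a1
  = a2 · T2 $ a1 · composite_monad l $ (a2 · T2 $ a1).
Proof. push; reflexivity. Qed.

Lemma phi21_bdry1 :
  a2 · T2 $ (a2 · T2 $ a1 · l A) · T2 $ T1 $ T2 $ a1
  = a2 · T2 $ a2 · T2 $ T2 $ a1 · T2 $ T2 $ T1 $ a1 · T2 $ l (T1 A).
Proof. push; rw (map1_eq T2 (dlaw_nat l a1)); reflexivity. Qed.

Lemma phi21_bdry2 :
  a2 · mu T2 A · T2 $ T2 $ a1 · T2 $ T2 $ T1 $ a1 · T2 $ l (T1 A)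
  = a2 · mu T2 A · T2 $ T2 $ (a1 · T1 $ a1) · T2 $ l (T1 A).
Proof. push; reflexivity. Qed.

Lemma phi21_bdry_tgt :
  a2 · mu T2 A · T2 $ T2 $ (a1 · mu T1 A) · T2 $ l (T1 A)
  = a2 · T2 $ a1 · mu (composite_monad l) A.
Proof.
push.
rw (mu_nat T2 a1).
reflexivity.
Qed.

(* [cast_cell] only rewrites the source and the target of the pasting into the
   form required of an associativity constraint. *)
Definition phi21
  (phi1 : cell (a1 · T1 $ a1) (a1 · mu T1 A))
  (phi2 : cell (a2 · T2 $ a2) (a2 · mu T2 A))
  (psi : cell (a1 · T1 $ a2) (a2 · T2 $ a1 · l A)) :
  cell (a2 · T2 $ a1 · composite_monad l $ (a2 · T2 $ a1))
       (a2 · T2 $ a1 · mu (composite_monad l) A) :=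
  cast_cell phi21_bdry_src phi21_bdry_tgt
    (a2 · mu T2 A ◁ T2 $$ T2 $$ phi1 ▷ T2 $ l (T1 A)
     □[phi21_bdry2] phi2 ▷ T2 $ T2 $ a1 ▷ T2 $ T2 $ T1 $ a1 ▷ T2 $ l (T1 A)
     □[phi21_bdry1] a2 ◁ T2 $$ psi ▷ T2 $ T1 $ T2 $ a1).

End LaxAlgebras.

Arguments is_normalized_lax_algebra {K} T A a phi.
Arguments is_lax_rewriting_rule {K T1 T2} l {A a1 a2} phi1 phi2 psi.
Arguments phi21 {K T1 T2} l {A a1 a2} phi1 phi2 psi.

(* Main.v *)
Require Import Defs.
From Stdlib Require Import List Eqdep.
Import ListNotations.

Set Implicit Arguments.
Unset Strict Implicit.
Unset Printing Implicit Defensive.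

(** The associativity axiom for phi21 is an equality between two pastings of
    six 2-cells each.  Both lead from three nested copies of the composite
    structure map a2 . T2 a1 to a single one, and one pasting is turned into the
    other by thirteen local moves ([chain21_assoc]): the first axiom of the
    rewriting rule pushes psi past phi1, the associativity of phi2 and that of
    phi1 are used once each, the second axiom of the rewriting rule pushes psi
    past phi2, and the nine remaining moves are interchanges of 2-cells acting
    at disjoint places.  For the unit axioms, naturality brings the unit next to each of the three
    factors of phi21, and each of them becomes an identity ([chain21_unitl],
    [chain21_unitr]).

    What makes such a computation delicate is that 1-cells compose
    associatively, and the monads preserve composition, only up to a
    propositional equality.  A 2-cell is therefore packed with its boundary into
    one type [Cell A B], on which whiskering and the functors are total
    operations and all coherence laws become Leibniz equations.  Vertical
    composition stays partial: a pasting is a list of cells, and [pastes L D]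
    says that the list [L] is composable with composite [D].  A local move is a
    relation [L ≈ L'] between two lists with a common composite; it is stable
    under whiskering and under functors, and may be applied inside a longer list
    ([pastes_subst]) with no condition on boundaries left to check.  Between two
    moves the cells of a list are brought to a normal form, in which the
    naturality squares have carried all multiplications and all components of
    the distributive law to the right of the 2-cell, so that the next move
    applies syntactically. *)

(** * Two-cells packed with their boundary *)

Record Cell {K : TwoCat} (A B : K) := pack {
  src : hom A B;
  tgt : hom A B;
  body : cell src tgt
}.
Arguments pack {K A B src tgt} body.

Lemma heq_pack {K : TwoCat} {A B : K} {f g f' g' : hom A B}
  (b : cell f g) (b' : cell f' g') : b ≃ b' -> pack b = pack b'.
Proof. intros []; reflexivity. Qed.

Lemma pack_heq {K : TwoCat} {A B : K} {f g f' g' : hom A B}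
  (b : cell f g) (b' : cell f' g') : pack b = pack b' -> b ≃ b'.
Proof.
intros e; change (body (pack b) ≃ body (pack b')).
rewrite e; exact heq_refl.
Qed.

Definition lwhisk {K : TwoCat} {A B C : K} (g : hom B C) (P : Cell A B) : Cell A C :=
  pack (g ◁ body P).

Definition rwhisk {K : TwoCat} {A B C : K} (P : Cell B C) (f : hom A B) : Cell A C :=
  pack (body P ▷ f).

Definition fmap {C D : TwoCat} (F : TwoFunctor C D) {A B : C} (P : Cell A B) :
  Cell (F A) (F B) := pack (F $$ body P).

Definition pid {K : TwoCat} {A B : K} (f : hom A B) : Cell A B := pack (id2 f).

(** The body is the composition used by the axioms of lax algebras and of
    rewriting rules, so that these translate without any transport. *)
Definition vpaste {K : TwoCat} {A B : K} (P Q : Cell A B) (e : tgt Q = src P) :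
  Cell A B := pack (body P □[e] body Q).

Notation "g ⊳ P" := (lwhisk g P) (at level 42, right associativity) : twocat_scope.
Notation "P ⊲ f" := (rwhisk P f) (at level 41, left associativity) : twocat_scope.

Section Whiskering.
Context {K : TwoCat}.

Lemma pack_lwhisker {A B C : K} (g : hom B C) (f f' : hom A B) (b : cell f f') :
  pack (g ◁ b) = g ⊳ pack b.
Proof. reflexivity. Qed.

Lemma pack_rwhisker {A B C : K} (g g' : hom B C) (b : cell g g') (f : hom A B) :
  pack (b ▷ f) = pack b ⊲ f.
Proof. reflexivity. Qed.

Lemma pack_map2 {C D : TwoCat} (F : TwoFunctor C D) {A B : C} (f f' : hom A B)
  (b : cell f f') : pack (F $$ b) = fmap F (pack b).
Proof. reflexivity. Qed.

Lemma lwhisk_comp {A B C D : K} (h : hom C D) (g : hom B C) (P : Cell A B) :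
  (h · g) ⊳ P = h ⊳ g ⊳ P.
Proof.
apply heq_pack; unfold lwhisker; rewrite <- hcomp_id2; apply hcompA.
Qed.

Lemma rwhisk_comp {A B C D : K} (P : Cell C D) (g : hom B C) (f : hom A B) :
  P ⊲ g ⊲ f = P ⊲ (g · f).
Proof.
apply heq_pack; cbn; unfold rwhisker; rewrite <- hcomp_id2; apply hcompA.
Qed.

Lemma lwhisk_rwhisk {A B C D : K} (h : hom C D) (P : Cell B C) (f : hom A B) :
  (h ⊳ P) ⊲ f = h ⊳ P ⊲ f.
Proof. apply heq_pack, hcompA. Qed.

Lemma lwhisk_id {A B : K} (P : Cell A B) : id1 B ⊳ P = P.
Proof. destruct P; apply heq_pack, hcomp_idl. Qed.

Lemma lwhisk_pid {A B C : K} (g : hom B C) (f : hom A B) : g ⊳ pid f = pid (g · f).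
Proof. apply heq_pack, heq_eq, hcomp_id2. Qed.

Lemma rwhisk_pid {A B C : K} (g : hom B C) (f : hom A B) : pid g ⊲ f = pid (g · f).
Proof. apply heq_pack, heq_eq, hcomp_id2. Qed.

Lemma fmap_lwhisk (T : TwoFunctor K K) {A B C : K} (g : hom B C) (P : Cell A B) :
  fmap T (g ⊳ P) = T $ g ⊳ fmap T P.
Proof.
apply heq_pack; cbn; unfold lwhisker; rewrite <- map2_id; apply map2_hcomp.
Qed.

Lemma fmap_rwhisk (T : TwoFunctor K K) {A B C : K} (P : Cell B C) (f : hom A B) :
  fmap T (P ⊲ f) = fmap T P ⊲ T $ f.
Proof.
apply heq_pack; cbn; unfold rwhisker; rewrite <- map2_id; apply map2_hcomp.
Qed.

Lemma fmap_pid (T : TwoFunctor K K) {A B : K} (f : hom A B) :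
  fmap T (pid f) = pid (T $ f).
Proof. apply heq_pack, heq_eq, map2_id. Qed.

Lemma lwhisk_eq {A B C D : K} {g : hom C D} {f : hom B C} {k : hom B D}
  (e : g · f = k) (P : Cell A B) : g ⊳ f ⊳ P = k ⊳ P.
Proof. now rewrite <- lwhisk_comp, e. Qed.

Lemma nat_cell {C : TwoCat} {F G : TwoFunctor C K} (n : TwoNat F G) {A B : C}
  (P : Cell A B) : n B ⊳ fmap F P = fmap G P ⊲ n A.
Proof. apply heq_pack, nat2. Qed.

Lemma slide_map (T : TwoFunctor K K) {A A' B C : K} {n : hom A A'} {m : hom B C}
  {P : Cell A B} {P' : Cell A' C} :
  m ⊳ P = P' ⊲ n -> T $ m ⊳ fmap T P = fmap T P' ⊲ T $ n.
Proof. intros e; now rewrite <- fmap_lwhisk, e, fmap_rwhisk. Qed.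

(** In a normal form a cell carries its right whiskers, so that a naturality
    square has to be applied underneath them. *)
Lemma slide_rwhisk {X A A' B C : K} {n : hom A A'} {m : hom B C}
  {P : Cell A B} {P' : Cell A' C} (e : m ⊳ P = P' ⊲ n) (f : hom X A) :
  m ⊳ P ⊲ f = P' ⊲ (n · f).
Proof. now rewrite <- lwhisk_rwhisk, e, rwhisk_comp. Qed.

End Whiskering.

(** * Pasting chains *)

Section Chains.
Context {K : TwoCat}.

(** The head of the list is the last 2-cell to be applied, as in the written
    order of vertical composites. *)
Inductive pastes {A B : K} : list (Cell A B) -> Cell A B -> Prop :=
| pastes_nil (f : hom A B) : pastes [] (pid f)
| pastes_cons (P : Cell A B) L Q (e : tgt Q = src P) :
    pastes L Q -> pastes (P :: L) (vpaste e).

(** Asking for a common composite, rather than for an equivalence of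
    [pastes L] and [pastes L'], includes the composability of both lists; this is
    what survives whiskering, which may make incomposable lists composable. *)
Definition same_pasting {A B : K} (L L' : list (Cell A B)) : Prop :=
  exists D, pastes L D /\ pastes L' D.
Infix "≈" := same_pasting (at level 70).

Lemma vpaste_idl {A B : K} (f : hom A B) (P : Cell A B) (e : tgt P = src (pid f)) :
  vpaste e = P.
Proof.
destruct P as [g h b]; cbn in e; destruct e.
apply heq_pack, heq_eq, vcomp_idl.
Qed.

Lemma vpaste_idr {A B : K} (f : hom A B) (P : Cell A B) (e : tgt (pid f) = src P) :
  vpaste e = P.
Proof.
destruct P as [g h b]; cbn in e; destruct e.
apply heq_pack, heq_eq, vcomp_idr.
Qed.

Lemma vpasteA {A B : K} (P Q R : Cell A B) (e : tgt Q = src P) (e' : tgt R = src Q) :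
  vpaste (P := vpaste e) (Q := R) e' = vpaste (P := P) (Q := vpaste e') e.
Proof.
destruct P as [p p' P], Q as [q q' Q], R as [r r' R]; cbn in e, e'; destruct e, e'.
apply heq_pack, heq_eq, vcompA.
Qed.

(** Uniqueness of identity proofs makes the composite independent of the chosen
    equality of boundaries. *)
Lemma vpaste_ext {A B : K} {P P' Q Q' : Cell A B}
  (e : tgt Q = src P) (e' : tgt Q' = src P') :
  P = P' -> Q = Q' -> vpaste e = vpaste e'.
Proof. intros <- <-; now rewrite (UIP _ _ _ e e'). Qed.

Lemma pastes_one {A B : K} (P : Cell A B) : pastes [P] P.
Proof.
rewrite <- (vpaste_idr (f := src P) (P := P) eq_refl) at 2.
apply pastes_cons, pastes_nil.
Qed.

Lemma pastes_app {A B : K} L L' (P Q : Cell A B) (e : tgt Q = src P) :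
  pastes L P -> pastes L' Q -> pastes (L ++ L') (vpaste e).
Proof.
intros H; revert Q e; induction H as [f | P L R e H IH]; intros Q e' HQ; cbn.
- now rewrite vpaste_idl.
- rewrite vpasteA; apply pastes_cons, IH, HQ.
Qed.

Lemma pastes_app_inv {A B : K} L L' (D : Cell A B) : pastes (L ++ L') D ->
  exists P Q (e : tgt Q = src P), pastes L P /\ pastes L' Q /\ D = vpaste e.
Proof.
revert D; induction L as [|P L IH]; intros D H; cbn in H.
- exists (pid (tgt D)), D, eq_refl; repeat split; auto using pastes_nil.
  now rewrite vpaste_idl.
- inversion H as [|P' L'' Q e HQ]; subst.
  destruct (IH _ HQ) as (R & S & e' & HR & HS & ->).
  exists (vpaste (P := P) (Q := R) e), S, e'; repeat split; auto using pastes_cons.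
  now rewrite vpasteA.
Qed.

(** The list has to be nonempty: every identity is a composite of the empty
    one.  This is also why the replaced list in [pastes_subst] is nonempty. *)
Lemma pastes_unique {A B : K} P L (D D' : Cell A B) :
  pastes (P :: L) D -> pastes (P :: L) D' -> D = D'.
Proof.
revert P D D'; induction L as [|Q L IH]; intros P D D' H H';
  inversion H as [|? ? R e HR]; inversion H' as [|? ? R' e' HR']; subst.
- inversion HR; inversion HR'; subst; now rewrite !vpaste_idr.
- apply vpaste_ext; eauto.
Qed.

Lemma pastes_subst {A B : K} (pre : list (Cell A B)) {P L L' post D} :
  pastes (pre ++ (P :: L) ++ post) D -> P :: L ≈ L' -> pastes (pre ++ L' ++ post) D.
Proof.
intros H (E & HE & HE').
destruct (pastes_app_inv H) as (Q & R & e & HQ & HR & ->).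
destruct (pastes_app_inv HR) as (S & U & e' & HS & HU & ->).
apply pastes_app; trivial; apply pastes_app; trivial.
now rewrite (pastes_unique HS HE).
Qed.

Lemma pastes_pid_cons {A B : K} (f : hom A B) L (D : Cell A B) :
  pastes (pid f :: L) D -> pastes L D.
Proof.
intros H; inversion H as [|P L' Q e HQ]; subst; now rewrite vpaste_idl.
Qed.

Lemma pastes_lwhisk {A B C : K} (g : hom B C) L (P : Cell A B) :
  pastes L P -> pastes (map (lwhisk g) L) (g ⊳ P).
Proof.
induction 1 as [f | P L Q e H IH]; cbn.
- rewrite lwhisk_pid; apply pastes_nil.
- assert (E : g ⊳ vpaste e
    = vpaste (P := g ⊳ P) (Q := g ⊳ Q) (f_equal (comp1 g) e)).
  { destruct P as [p p' P], Q as [q q' Q]; cbn in e; destruct e.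
    apply heq_pack, heq_eq; cbn; unfold vcomp_along, lwhisker; cbn.
    now rewrite <- interchange, vcomp_idl. }
  rewrite E; now apply pastes_cons.
Qed.

Lemma pastes_rwhisk {A B C : K} (f : hom A B) L (P : Cell B C) :
  pastes L P -> pastes (map (fun Q => Q ⊲ f) L) (P ⊲ f).
Proof.
induction 1 as [g | P L Q e H IH]; cbn.
- rewrite rwhisk_pid; apply pastes_nil.
- assert (E : vpaste e ⊲ f
    = vpaste (P := P ⊲ f) (Q := Q ⊲ f) (f_equal (fun g => g · f) e)).
  { destruct P as [p p' P], Q as [q q' Q]; cbn in e; destruct e.
    apply heq_pack, heq_eq; cbn; unfold vcomp_along, rwhisker; cbn.
    now rewrite <- interchange, vcomp_idl. }
  rewrite E; now apply pastes_cons.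
Qed.

Lemma pastes_fmap (T : TwoFunctor K K) {A B : K} L (P : Cell A B) :
  pastes L P -> pastes (map (fmap T) L) (fmap T P).
Proof.
induction 1 as [g | P L Q e H IH]; cbn.
- rewrite fmap_pid; apply pastes_nil.
- assert (E : fmap T (vpaste e)
    = vpaste (P := fmap T P) (Q := fmap T Q) (f_equal (map1 T) e)).
  { destruct P as [p p' P], Q as [q q' Q]; cbn in e; destruct e.
    apply heq_pack, heq_eq, map2_vcomp. }
  rewrite E; now apply pastes_cons.
Qed.

Lemma same_lwhisk {A B C : K} (g : hom B C) {L L' : list (Cell A B)} :
  L ≈ L' -> map (lwhisk g) L ≈ map (lwhisk g) L'.
Proof. intros (D & H & H'); exists (g ⊳ D); auto using pastes_lwhisk. Qed.

Lemma same_rwhisk {A B C : K} (f : hom A B) {L L' : list (Cell B C)} :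
  L ≈ L' -> map (fun Q => Q ⊲ f) L ≈ map (fun Q => Q ⊲ f) L'.
Proof. intros (D & H & H'); exists (D ⊲ f); auto using pastes_rwhisk. Qed.

Lemma same_fmap (T : TwoFunctor K K) {A B : K} {L L' : list (Cell A B)} :
  L ≈ L' -> map (fmap T) L ≈ map (fmap T) L'.
Proof. intros (D & H & H'); exists (fmap T D); auto using pastes_fmap. Qed.

Lemma pastes_vcomp_along {A B : K} {f g g' h : hom A B} {L L'}
  (c : cell g' h) (e : g = g') (b : cell f g) :
  pastes L (pack c) -> pastes L' (pack b) -> pastes (L ++ L') (pack (c □[e] b)).
Proof. exact (pastes_app (P := pack c) (Q := pack b) e). Qed.

(** The horizontal composite of two 2-cells, factored in its two ways. *)
Lemma exchange {A B C : K} {g g' : hom B C} {f f' : hom A B}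
  (c : cell g g') (b : cell f f') :
  [pack c ⊲ f'; g ⊳ pack b] ≈ [g' ⊳ pack b; pack c ⊲ f].
Proof.
exists (pack (hcomp c b)); split.
- assert (E : pack (hcomp c b) = pack ((c ▷ f') □[eq_refl] (g ◁ b))).
  { apply heq_pack, heq_eq; cbn; unfold vcomp_along, lwhisker, rwhisker; cbn.
    now rewrite <- interchange, vcomp_idl, vcomp_idr. }
  rewrite E; exact (pastes_vcomp_along (L := [_]) eq_refl (pastes_one _) (pastes_one _)).
- assert (E : pack (hcomp c b) = pack ((g' ◁ b) □[eq_refl] (c ▷ f))).
  { apply heq_pack, heq_eq; cbn; unfold vcomp_along, lwhisker, rwhisker; cbn.
    now rewrite <- interchange, vcomp_idl, vcomp_idr. }
  rewrite E; exact (pastes_vcomp_along (L := [_]) eq_refl (pastes_one _) (pastes_one _)).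
Qed.

Lemma pack_cast_cell {A B : K} {f f' g g' : hom A B} (ef : f = f') (eg : g = g')
  (b : cell f g) : pack (cast_cell ef eg b) = pack b.
Proof. now destruct ef, eg. Qed.

End Chains.
Infix "≈" := same_pasting (at level 70).

Lemma same_sym {K : TwoCat} {A B : K} {L L' : list (Cell A B)} : L ≈ L' -> L' ≈ L.
Proof. intros (D & H & H'); now exists D. Qed.

Lemma same_vcomp_along {K : TwoCat} {A B : K} {L L' : list (Cell A B)} {P Q} :
  P = Q -> pastes L P -> pastes L' Q -> L ≈ L'.
Proof. intros <- H H'; now exists P. Qed.

(** * Structure maps of the monads and normal forms of cells *)

Section CleanBoundaries.
Context {K : TwoCat}.

(** The components of the monads and of the distributive law, retyped so that
    no composite functor occurs in a boundary: rewriting is syntactic, and a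
    composite functor applied to an object is only convertible to the iterated
    application. *)
Definition mmult (T : TwoMonad K) (A : K) : hom (T (T A)) (T A) := mu T A.
Definition munit (T : TwoMonad K) (A : K) : hom A (T A) := eta T A.

Context (T : TwoMonad K).

Lemma mmult_nat {A B : K} (f : hom A B) : mmult T B · T $ T $ f = T $ f · mmult T A.
Proof. exact (nat1 (mu T) f). Qed.

Lemma mmult_nat2 {A B : K} (P : Cell A B) :
  mmult T B ⊳ fmap T (fmap T P) = fmap T P ⊲ mmult T A.
Proof. exact (nat_cell (mu T) P). Qed.

Lemma mmult_assoc (A : K) : mmult T A · T $ mmult T A = mmult T A · mmult T (T A).
Proof. exact (mu_assoc T A). Qed.

(** Units move to the left, towards the structure maps that absorb them, whereas
    multiplications and the distributive law move to the right. *)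
Lemma munit_nat {A B : K} (f : hom A B) : T $ f · munit T A = munit T B · f.
Proof. exact (eq_sym (nat1 (eta T) f)). Qed.

Lemma munit_nat2 {A B : K} (P : Cell A B) : fmap T P ⊲ munit T A = munit T B ⊳ P.
Proof. exact (eq_sym (nat_cell (eta T) P)). Qed.

Lemma mmult_unitl (A : K) : mmult T A · munit T (T A) = id1 (T A).
Proof. exact (mu_unitl T A). Qed.

Lemma mmult_unitr (A : K) : mmult T A · T $ munit T A = id1 (T A).
Proof. exact (mu_unitr T A). Qed.

Context {T1 T2 : TwoMonad K}.

Definition swap (l : DistributiveLaw T1 T2) (A : K) :
  hom (T1 (T2 A)) (T2 (T1 A)) := l A.

Context (l : DistributiveLaw T1 T2).

Lemma swap_nat {A B : K} (f : hom A B) :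
  swap l B · T1 $ T2 $ f = T2 $ T1 $ f · swap l A.
Proof. exact (nat1 l f). Qed.

Lemma swap_nat2 {A B : K} (P : Cell A B) :
  swap l B ⊳ fmap T1 (fmap T2 P) = fmap T2 (fmap T1 P) ⊲ swap l A.
Proof. exact (nat_cell l P). Qed.

Lemma swap_mult1 (A : K) :
  swap l A · mmult T1 (T2 A) = T2 $ mmult T1 A · swap l (T1 A) · T1 $ swap l A.
Proof. exact (dlaw_mu1 l A). Qed.

Lemma swap_mult2 (A : K) :
  swap l A · T1 $ mmult T2 A = mmult T2 (T1 A) · T2 $ swap l A · swap l (T2 A).
Proof. exact (dlaw_mu2 l A). Qed.

Lemma swap_unit1 (A : K) : swap l A · munit T1 (T2 A) = T2 $ munit T1 A.
Proof. exact (dlaw_eta1 l A). Qed.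

Lemma swap_unit2 (A : K) : swap l A · T1 $ munit T2 A = munit T2 (T1 A).
Proof. exact (dlaw_eta2 l A). Qed.

End CleanBoundaries.

Lemma lax_assoc_chains {K : TwoCat} {T : TwoMonad K} {A : K} {a : hom (T A) A}
  {phi : cell (a · T $ a) (a · mmult T A)} :
  is_normalized_lax_algebra T A a phi ->
  [pack phi ⊲ mmult T (T A); pack phi ⊲ T $ T $ a]
  ≈ [pack phi ⊲ T $ mmult T A; a ⊳ fmap T (pack phi)].
Proof.
intros H; eapply same_vcomp_along; [exact (heq_pack (lax_assoc H))| |];
  apply (pastes_vcomp_along (L := [_])); apply pastes_one.
Qed.

(* [redex1 g f] is the oriented equation that rewrites the composite g · f of
   two irreducible 1-cells, and [redex2 g P] the naturality square carrying g to
   the right of the cell P; both look under the functors applied to g, and fail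
   if nothing applies.  Finding the redex by matching keeps the rewriting on
   closed terms. *)
Ltac redex1 g f :=
  lazymatch g with
  | ?F $ ?g' => lazymatch f with
    | F $ ?f' => let e := redex1 g' f' in constr:(map1_eq F e)
    | munit ?T _ => constr:(munit_nat T g')
    end
  | mmult ?T _ => lazymatch f with
    | endo T $ endo T $ ?h => constr:(mmult_nat T h)
    | endo T $ mmult T ?B => constr:(mmult_assoc T B)
    end
  | swap ?l _ => lazymatch type of l with DistributiveLaw ?T1 ?T2 =>
    lazymatch f with
    | endo T1 $ endo T2 $ ?h => constr:(swap_nat l h)
    | mmult T1 (map0 _ ?B) => constr:(swap_mult1 l B)
    | endo T1 $ mmult T2 ?B => constr:(swap_mult2 l B)
    | munit T1 (map0 _ ?B) => constr:(swap_unit1 l B)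
    | endo T1 $ munit T2 ?B => constr:(swap_unit2 l B)
    end end
  end.

Ltac redex2 g P :=
  lazymatch g with
  | ?F $ ?g' => lazymatch P with
    | fmap F ?Q => let e := redex2 g' Q in constr:(slide_map F e)
    end
  | mmult ?T _ => lazymatch P with
    | fmap (endo T) (fmap (endo T) ?Q) => constr:(mmult_nat2 T Q)
    end
  | swap ?l _ => lazymatch type of l with DistributiveLaw ?T1 ?T2 =>
    lazymatch P with
    | fmap (endo T1) (fmap (endo T2) ?Q) => constr:(swap_nat2 l Q)
    end end
  end.

Ltac unpack :=
  repeat first [rewrite pack_lwhisker | rewrite pack_rwhisker | rewrite pack_map2].

Ltac expand :=
  rewrite ?fmap_lwhisk, ?fmap_rwhisk, ?map1_comp, ?lwhisk_rwhisk,
    ?rwhisk_comp, ?lwhisk_comp, ?comp1A.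

Ltac slide e :=
  let H := fresh in pose proof e as H;
  rewrite ?map1_comp, ?lwhisk_comp, ?comp1A in H; rewrite H; clear H.

Ltac normalize :=
  repeat match goal with
  | |- context [?g · ?f] => let e := redex1 g f in slide e
  | |- context [?g · (?f · ?h)] => let e := redex1 g f in slide (comp_pre e h)
  | |- context [?g ⊳ ?f ⊳ ?P] => let e := redex1 g f in slide (lwhisk_eq e P)
  | |- context [?g ⊳ ?P ⊲ ?f] => let e := redex2 g P in slide (slide_rwhisk e f)
  | |- context [?g ⊳ ?P] => let e := redex2 g P in slide e
  end.

(* Each cell is normalized in a goal of its own, where few subterms have to be
   searched. *)
Ltac norm_cells tac L :=
  lazymatch L with
  | [] => idtac
  | ?P :: ?L' =>
    let Q := open_constr:(_) in
    let E := fresh in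
    assert (E : P = Q) by (tac; reflexivity);
    rewrite E; clear E; norm_cells tac L'
  end.
Ltac norm_goal tac :=
  cbn [map app];
  lazymatch goal with
  | |- pastes ?L _ -> _ => norm_cells tac L
  | |- pastes ?L _ => norm_cells tac L
  | |- ?L ≈ ?L' -> _ => norm_cells tac L; norm_cells tac L'
  end.

(** * The composite algebra *)

Section CompositeAlgebra.
Context {K : TwoCat} {T1 T2 : TwoMonad K} (l : DistributiveLaw T1 T2).
Context {A : K}
  (a1 : hom (T1 A) A) (phi1 : cell (a1 · T1 $ a1) (a1 · mmult T1 A))
  (a2 : hom (T2 A) A) (phi2 : cell (a2 · T2 $ a2) (a2 · mmult T2 A))
  (psi : cell (a1 · T1 $ a2) (a2 · T2 $ a1 · swap l A)).
Context (H1 : is_normalized_lax_algebra T1 A a1 phi1).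
Context (H2 : is_normalized_lax_algebra T2 A a2 phi2).
Context (HR : is_lax_rewriting_rule l phi1 phi2 psi).

(* Rewriting does not look into local definitions.  It would otherwise try to
   reassociate the boundaries stored in the packed cells, where the result is
   ill-typed. *)
Let Phi1 := pack phi1.
Let Phi2 := pack phi2.
Let Psi := pack psi.
Let alpha := a2 · T2 $ a1.
Let chain21 : list (Cell (T2 (T1 (T2 (T1 A)))) A) :=
  [a2 · mmult T2 A ⊳ fmap T2 (fmap T2 Phi1) ⊲ T2 $ swap l (T1 A);
   Phi2 ⊲ T2 $ T2 $ a1 ⊲ T2 $ T2 $ T1 $ a1 ⊲ T2 $ swap l (T1 A);
   a2 ⊳ fmap T2 Psi ⊲ T2 $ T1 $ T2 $ a1].

Lemma chain21_pastes : pastes chain21 (pack (phi21 l phi1 phi2 psi)).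
Proof.
unfold phi21; rewrite pack_cast_cell; unfold chain21; rewrite <- !lwhisk_rwhisk.
apply (pastes_vcomp_along (L := [_])); [apply pastes_one|].
apply (pastes_vcomp_along (L := [_])); apply pastes_one.
Qed.

Lemma rewriting1_chains : [Psi ⊲ mmult T1 (T2 A); Phi1 ⊲ T1 $ T1 $ a2]
  ≈ [a2 ⊳ fmap T2 Phi1 ⊲ swap l (T1 A) ⊲ T1 $ swap l A;
     Psi ⊲ T1 $ T2 $ a1 ⊲ T1 $ swap l A;
     a1 ⊳ fmap T1 Psi].
Proof.
eapply same_vcomp_along; [exact (heq_pack (rewriting_mult1 HR))| |];
  rewrite <- ?lwhisk_rwhisk;
  repeat (apply (pastes_vcomp_along (L := [_])); [apply pastes_one|]);
  apply pastes_one.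
Qed.

Lemma rewriting2_chains : [Phi2 ⊲ T2 $ T2 $ a1 ⊲ T2 $ swap l A ⊲ swap l (T2 A);
     a2 ⊳ fmap T2 Psi ⊲ swap l (T2 A);
     Psi ⊲ T1 $ T2 $ a2]
  ≈ [Psi ⊲ T1 $ mmult T2 A; a1 ⊳ fmap T1 Phi2].
Proof.
eapply same_vcomp_along; [exact (heq_pack (rewriting_mult2 HR))| |];
  rewrite <- ?lwhisk_rwhisk;
  repeat (apply (pastes_vcomp_along (L := [_])); [apply pastes_one|]);
  apply pastes_one.
Qed.

Let assoc1 := lax_assoc_chains H1 : [Phi1 ⊲ mmult T1 (T1 A); Phi1 ⊲ T1 $ T1 $ a1]
  ≈ [Phi1 ⊲ T1 $ mmult T1 A; a1 ⊳ fmap T1 Phi1].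
Let assoc2 := lax_assoc_chains H2 : [Phi2 ⊲ mmult T2 (T2 A); Phi2 ⊲ T2 $ T2 $ a2]
  ≈ [Phi2 ⊲ T2 $ mmult T2 A; a2 ⊳ fmap T2 Phi2].

(* A functor applied to whiskers on both sides needs two rounds of expansion. *)
Ltac norm_cell := unpack; fold Phi1 Phi2 Psi; expand; expand; normalize.
Ltac nf := norm_goal norm_cell.

(* Rewrites, from position i on, the list of cells of H by the move R. *)
Ltac step H i R :=
  let E := fresh in pose proof R as E; revert E; nf; intro E;
  match type of H with pastes ?L _ =>
    let pre := eval cbn in (firstn i L) in
    match type of E with ?P :: ?M ≈ ?N =>
    let post := eval cbn in (skipn (length pre + length (P :: M)) L) in
    let H' := fresh in
    pose proof (pastes_subst (pre := pre) (P := P) (L := M) (L' := N)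
      (post := post) H E) as H';
    clear H; rename H' into H
    end
  end; cbn [app] in H; clear E.

Notation "F $* E" := (same_fmap F E) (at level 35, right associativity).
Notation "g ◁* E" := (same_lwhisk g E) (at level 42, right associativity).
Notation "E ▷* f" := (same_rwhisk f E) (at level 41, left associativity).

Let mu21A (B : K) : hom (T2 (T1 (T2 (T1 B)))) (T2 (T1 B)) :=
  mmult T2 (T1 B) · T2 $ T2 $ mmult T1 B · T2 $ swap l (T1 B).
Let eta21A (B : K) : hom B (T2 (T1 B)) := munit T2 (T1 B) · munit T1 B.

(* The reordering of T2 T1 T2 T1 T2 T1 A into T2 T2 T2 T1 T1 T1 A, over which the
   associativity constraints of both algebras are whiskered. *)
Local Notation sort3 :=
  (T2 $ T2 $ swap l (T1 (T1 A)) · T2 $ T2 $ T1 $ swap l (T1 A)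
   · T2 $ swap l (T1 (T2 (T1 A)))).

(** Both lists read phi1, phi2, psi, phi1, phi2, psi, from the last 2-cell to the
    first.  A cell that moves up in the comments below is applied later. *)
Lemma chain21_assoc D :
  pastes (map (fun Q => Q ⊲ mu21A (T2 (T1 A))) chain21 ++
    map (fun Q => Q ⊲ T2 $ T1 $ T2 $ T1 $ alpha) chain21) D ->
  pastes (map (fun Q => Q ⊲ T2 $ T1 $ mu21A A) chain21 ++
    map (lwhisk alpha) (map (fmap T2) (map (fmap T1) chain21))) D.
Proof.
unfold chain21, alpha, mu21A; intros H; nf; revert H; nf; intro H.
(* The phi1 of the first constraint is followed by the psi of the second. *)
step H 2 (a2 · mmult T2 A ◁* T2 $* T2 $* (rewriting1_chains ▷* T1 $ T1 $ T2 $ a1)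
    ▷* T2 $ swap l _).
(* The first phi2 goes up past both psi, the second one down past phi1. *)
step H 4 (same_sym (exchange phi2
    (T2 $$ T2 $$ (a1 ◁ T1 $$ psi ▷ T1 $ T1 $ T2 $ a1) ▷ T2 $ swap l _))).
step H 3 (same_sym (exchange phi2
    (T2 $$ T2 $$ (psi ▷ (T1 $ T2 $ a1 · T1 $ swap l _ · T1 $ T1 $ T2 $ a1)) ▷ T2 $ swap l _))).
step H 1 (exchange (phi2 ▷ mmult T2 _) (T2 $$ T2 $$ T2 $$ (phi1 ▷ T1 $ T1 $ a1) ▷ sort3)).
(* The two phi2, and above them the two phi1, have become adjacent. *)
step H 2 (assoc2 ▷* T2 $ T2 $ T2 $ (a1 · T1 $ a1 · T1 $ T1 $ a1) ▷* sort3).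
step H 0 (a2 · mmult T2 A · mmult T2 _ ◁* T2 $* T2 $* T2 $* assoc1 ▷* sort3).
(* The lower phi1 goes down past both phi2 and the uppermost psi. *)
step H 1 (same_sym (exchange (phi2 ▷ T2 $ mmult T2 _)
    (T2 $$ T2 $$ T2 $$ (a1 ◁ T1 $$ phi1) ▷ sort3))).
step H 2 (same_sym (exchange (a2 ◁ T2 $$ phi2)
    (T2 $$ T2 $$ T2 $$ (a1 ◁ T1 $$ phi1) ▷ sort3))).
step H 3 (same_sym (exchange (a2 · T2 $ a2 ◁ T2 $$ T2 $$ psi)
    (T2 $$ T2 $$ T1 $$ T2 $$ phi1 ▷ (T2 $ T2 $ T1 $ swap l _ · T2 $ swap l _)))).
(* The two lower psi trade places, and the same phi1 goes down past one of
   them. *)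
step H 5 (same_sym (exchange (a2 ◁ T2 $$ psi)
    (T2 $$ T1 $$ T2 $$ psi ▷ T2 $ T1 $ T2 $ T1 $ T2 $ a1))).
step H 4 (same_sym (exchange (a2 ◁ T2 $$ psi)
    (T2 $$ T1 $$ (T2 $ a2 ◁ T2 $$ T2 $$ phi1 ▷ T2 $ swap l _)))).
(* The lower phi2 now follows two adjacent psi. *)
step H 2 (a2 ◁* T2 $* (rewriting2_chains
    ▷* T1 $ T2 $ T2 $ (a1 · mmult T1 A) ▷* T1 $ T2 $ swap l _)).
(* Only the order of phi1 and phi2 inside the functor T2 T1 is left. *)
step H 3 (a2 · T2 $ a1 ◁* T2 $* T1 $* exchange phi2 (T2 $$ T2 $$ phi1 ▷ T2 $ swap l _)).
exact H.
Qed.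

Let unit1 : a1 · munit T1 A = id1 A := lax_unit H1.
Let unit2 : a2 · munit T2 A = id1 A := lax_unit H2.
Let phi1_unitl : Phi1 ⊲ T1 $ munit T1 A = pid a1 := heq_pack (lax_unitl H1).
Let phi1_unitr : Phi1 ⊲ munit T1 (T1 A) = pid a1 := heq_pack (lax_unitr H1).
Let phi2_unitl : Phi2 ⊲ T2 $ munit T2 A = pid a2 := heq_pack (lax_unitl H2).
Let phi2_unitr : Phi2 ⊲ munit T2 (T2 A) = pid a2 := heq_pack (lax_unitr H2).
Let psi_unit1 : Psi ⊲ munit T1 (T2 A) = pid a2 := heq_pack (rewriting_unit1 HR).
Let psi_unit2 : Psi ⊲ T1 $ munit T2 A = pid a1 := heq_pack (rewriting_unit2 HR).

Lemma chain21_unitl D :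
  pastes (map (fun Q => Q ⊲ T2 $ T1 $ eta21A A) chain21) D -> D = pid alpha.
Proof.
unfold chain21, alpha, eta21A; nf.
rewrite (comp_pre (mmult_unitr T2 _)), comp1_idl.
rewrite (map1_eq T2 (map1_eq T1 unit1)), !map1_id, !comp1_idr.
rewrite <- rwhisk_comp, <- !fmap_rwhisk, phi1_unitl, phi2_unitl, psi_unit2.
rewrite !fmap_pid, !rwhisk_pid, !lwhisk_pid.
intros H; do 2 apply pastes_pid_cons in H.
exact (pastes_unique H (pastes_one _)).
Qed.

Lemma chain21_unitr D :
  pastes (map (fun Q => Q ⊲ eta21A (T2 (T1 A))) chain21) D -> D = pid alpha.
Proof.
unfold chain21, alpha, eta21A; nf.
rewrite (comp_pre (mmult_unitl T2 _)), comp1_idl.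
rewrite (comp_pre (map1_eq T2 unit1)), map1_id, comp1_idl.
rewrite <- !rwhisk_comp, <- fmap_rwhisk, phi1_unitr, phi2_unitr, munit_nat2.
rewrite !lwhisk_rwhisk, (lwhisk_eq unit2), lwhisk_id, psi_unit1.
rewrite !fmap_pid, !rwhisk_pid, !lwhisk_pid.
intros H; do 2 apply pastes_pid_cons in H.
exact (pastes_unique H (pastes_one _)).
Qed.

Lemma composite_unit : alpha · eta21A A = id1 A.
Proof.
unfold alpha, eta21A.
rewrite comp1A, (comp_pre (munit_nat T2 a1)), comp1A, unit1, comp1_idr.
exact unit2.
Qed.

Lemma composite_lax_algebra :
  is_normalized_lax_algebra (composite_monad l) A (a2 · T2 $ a1)
    (phi21 l phi1 phi2 psi).
Proof.
pose proof chain21_pastes as H.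
constructor.
- exact composite_unit.
- apply pack_heq, chain21_unitl.
  exact (pastes_rwhisk (T2 $ T1 $ eta21A A) H).
- apply pack_heq, chain21_unitr.
  exact (pastes_rwhisk (eta21A (T2 (T1 A))) H).
- apply pack_heq; refine (pastes_unique (chain21_assoc _) _).
  + exact (pastes_vcomp_along _
      (pastes_rwhisk (mu21A (T2 (T1 A))) H)
      (pastes_rwhisk (T2 $ T1 $ T2 $ T1 $ alpha) H)).
  + exact (pastes_vcomp_along _
      (pastes_rwhisk (T2 $ T1 $ mu21A A) H)
      (pastes_lwhisk alpha (pastes_fmap T2 (pastes_fmap T1 H)))).
Qed.

End CompositeAlgebra.

Theorem theorem5 :
  forall (K : TwoCat) (T1 T2 : TwoMonad K) (l : DistributiveLaw T1 T2),
  invertible l ->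
  forall (A : K)
    (a1 : hom (T1 A) A) (phi1 : cell (a1 · T1 $ a1) (a1 · mu T1 A))
    (a2 : hom (T2 A) A) (phi2 : cell (a2 · T2 $ a2) (a2 · mu T2 A))
    (psi : cell (a1 · T1 $ a2) (a2 · T2 $ a1 · l A)),
  is_normalized_lax_algebra T1 A a1 phi1 ->
  is_normalized_lax_algebra T2 A a2 phi2 ->
  is_lax_rewriting_rule l phi1 phi2 psi ->
  is_normalized_lax_algebra (composite_monad l) A (a2 · T2 $ a1)
    (phi21 l phi1 phi2 psi).
Proof.
intros K T1 T2 l _ A a1 phi1 a2 phi2 psi H1 H2 HR.
exact (composite_lax_algebra H1 H2 HR).
Qed.
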